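(* The boxed pattern $\mathrm{Box}(2413)$, the vincular pattern $2\underline{41}3$, and the bivincular pattern $(2413,\{2\},\{2\})$ are pairwise coincident; that is, for every permutation $\pi$, $\pi$ contains any one of these three patterns if and only if it contains each of the others.
   Context: $\mathfrak S_n$ is the set of permutations $\pi=\pi_1\cdots\pi_n$ of $\{1,\dots,n\}$. For $\tau\in\mathfrak S_k$, an occurrence of the boxed pattern $\mathrm{Box}(\tau)$ in $\pi\in\mathfrak S_n$ is a choice of positions $i_1<\cdots<i_k$ such that $\pi_{i_1}\cdots\pi_{i_k}$ is order-isomorphic to $\tau$ and there is no index $j\notin\{i_1,\dots,i_k\}$ with $i_1<j<i_k$ and $\min_r \pi_{i_r}<\pi_j<\max_r\pi_{i_r}$. A bivincular pattern of length $k$ is a triple $(\tau,X,Y)$ with $\tau\in\mathfrak S_k$ and $X,Y\subseteq\{1,\dots,k-1\}$; an occurrence of it in $\pi$ is a choice of positions $i_1<\cdots<i_k$ such that $\pi_{i_1}\cdots\pi_{i_k}$ is order-isomorphic to $\tau$, $i_{x+1}=i_x+1$ for every $x\in X$, and, if $v_1<\cdots<v_k$ are the selected values in increasing order, $v_{y+1}=v_y+1$ for every $y\in Y$. The vincular pattern $2\underline{41}3$ is $(2413,\{2\},\varnothing)$. A permutation contains a pattern if it has at least one occurrence of it. Two patterns are coincident if they are avoided by exactly the same permutations. *)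

(* Defs.v *)
From mathcomp Require Import all_boot all_fingroup.

Set Implicit Arguments.
Unset Strict Implicit.
Unset Printing Implicit Defensive.

(* Permutations of {1, ..., n} are elements of 'S_n: positions and values are
   numbered from 0. *)

(* Underlying permutation has length k.+1; the pattern is given by which
   selections of k.+1 positions of a permutation count as occurrences. *)
Definition pattern (k : nat) :=
  forall n : nat, 'S_n -> {ffun 'I_k.+1 -> 'I_n} -> bool.

Definition contains k (P : pattern k) n (pi : 'S_n) : bool :=
  [exists i : {ffun 'I_k.+1 -> 'I_n}, P n pi i].

Definition avoids k (P : pattern k) n (pi : 'S_n) : bool := ~~ contains P pi.

Definition coincident k l (P : pattern k) (Q : pattern l) : Prop :=
  forall (n : nat) (pi : 'S_n), avoids P pi <-> avoids Q pi.

Definition increasing k n (i : {ffun 'I_k -> 'I_n}) : bool :=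
  [forall a : 'I_k, forall b : 'I_k, (a < b) ==> (i a < i b)].

Definition order_isomorphic k n (tau : 'S_k) (pi : 'S_n)
    (i : {ffun 'I_k -> 'I_n}) : bool :=
  [forall a : 'I_k, forall b : 'I_k, (pi (i a) < pi (i b)) == (tau a < tau b)].

(* The default n is never the minimum, since all the values are below n. *)
Definition min_value k n (pi : 'S_n) (i : {ffun 'I_k -> 'I_n}) : nat :=
  \big[minn/n]_(r < k) pi (i r).

Definition max_value k n (pi : 'S_n) (i : {ffun 'I_k -> 'I_n}) : nat :=
  \max_(r < k) pi (i r).

Definition Box k (tau : 'S_k.+1) : pattern k := fun n pi i =>
  [&& increasing i, order_isomorphic tau pi i &
      ~~ [exists j : 'I_n, [&& j \notin codom i,
            i ord0 < j < i ord_max &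
            min_value pi i < pi j < max_value pi i]]].

Definition sorted_values k n (pi : 'S_n) (i : {ffun 'I_k -> 'I_n}) : seq nat :=
  sort leq [seq val (pi (i r)) | r : 'I_k].

(* x : 'I_k stands for the 1-based index x.+1 in {1, ..., k}, so x \in X glues
   the 0-based entries number x and x.+1; likewise for the values and Y. *)
Definition bivincular k (tau : 'S_k.+1) (X Y : {set 'I_k}) : pattern k :=
  fun n pi i =>
  [&& increasing i, order_isomorphic tau pi i,
      [forall x in X,
         i (lift ord0 x) == (i (widen_ord (leqnSn k) x)).+1 :> nat] &
      [forall y in Y,
         nth 0 (sorted_values pi i) y.+1 ==
         (nth 0 (sorted_values pi i) y).+1]].

Definition vincular k (tau : 'S_k.+1) (X : {set 'I_k}) : pattern k :=
  bivincular tau X set0.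

Definition word2413 (a : 'I_4) : 'I_4 := inord (nth 0 [:: 1; 3; 0; 2] a).

Lemma word2413_inj : injective word2413.
Proof.
move=> [[|[|[|[|//]]]] ha] [[|[|[|[|//]]]] hb] /(congr1 val);
  rewrite /= !inordK // => _; exact: val_inj.
Qed.

Definition perm2413 : 'S_4 := perm word2413_inj.

(* The 1-based index 2 of {1, 2, 3}. *)
Definition index2 : 'I_3 := @Ordinal 3 1 isT.

(* Main.v *)
Require Import Defs.
From mathcomp Require Import all_boot all_fingroup.
From mathcomp Require Import zify.

(** The coincidences follow from three implications between containments;
    that the bivincular pattern forces the vincular one is immediate.  Write an
    occurrence of 2413 as four positions a < b < c < d with
    pi c < pi a < pi d < pi b.

    Box to vincular ([vincular_of_Box]).  When the box is empty, each entry
    strictly between positions b and c is above pi b or below pi c.  Reading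
    from b to c, the entries go from high to low, so some adjacent pair
    crosses the box, and it can replace b, c.

    Vincular to bivincular ([bivincular_of_vincular]).  When c = b + 1, each
    position is at most b or at least c.  Reading the values from pi a up to
    pi d, their positions start on the left of the cut and end on its right, so
    some two consecutive values lie on opposite sides of it, and they can
    replace pi a, pi d.

    Vincular to box ([Box_of_vincular]).  Keep the adjacent pair b, c and take
    a, d as close as possible.  Minimality leaves no entry strictly between
    positions a and d with a value strictly between pi a and pi d, so the
    entries there are high (above pi d) or low (below pi a).  The lowest
    high entry b' and the highest low entry c' leave no room for an entry of
    the box of a, b', c', d; minimality also gives b' <= b and c <= c', so
    these four entries are in the right order.

    The first two arguments share the discrete crossing principle
    [ord_crossing]. *)

Set Implicit Arguments.
Unset Strict Implicit.
Unset Printing Implicit Defensive.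

(** * Selections of four positions *)

Lemma forall_ord4 (P : pred 'I_4) :
  [forall r, P r] = [&& P (@Ordinal 4 0 isT), P (@Ordinal 4 1 isT),
                        P (@Ordinal 4 2 isT) & P (@Ordinal 4 3 isT)].
Proof.
apply/forallP/and4P => [PT | [P0 P1 P2 P3] [[|[|[|[|//]]]] lt_r4]]; first by split.
- by rewrite (bool_irrelevance lt_r4 isT).
- by rewrite (bool_irrelevance lt_r4 isT).
- by rewrite (bool_irrelevance lt_r4 isT).
- by rewrite (bool_irrelevance lt_r4 isT).
Qed.

Definition quad n (a b c d : 'I_n) : {ffun 'I_4 -> 'I_n} :=
  [ffun r : 'I_4 => nth a [:: a; b; c; d] r].

Lemma quad_eta n (i : {ffun 'I_4 -> 'I_n}) :
  i = quad (i (@Ordinal 4 0 isT)) (i (@Ordinal 4 1 isT))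
           (i (@Ordinal 4 2 isT)) (i (@Ordinal 4 3 isT)).
Proof.
apply/ffunP=> r; apply/eqP; move: r; apply/forallP.
by rewrite forall_ord4 !ffunE !eqxx.
Qed.

(** Turns the existential over selections that defines containment into one
    over four named positions. *)
Lemma exists_quad n (P : pred {ffun 'I_4 -> 'I_n}) :
  [exists i, P i] <-> exists a b c d, P (quad a b c d).
Proof.
split=> [/existsP[i Pi] | [a [b [c [d Pq]]]]]; last by apply/existsP; exists (quad a b c d).
by move: Pi; rewrite (quad_eta i); do 4![eexists]; exact: Pi.
Qed.

Lemma perm2413E (a : 'I_4) : perm2413 a = nth 0 [:: 1; 3; 0; 2] a :> nat.
Proof.
by rewrite permE /word2413 inordK //; case: a => [[|[|[|[|//]]]]].
Qed.

Definition is2413 n (pi : 'S_n) (a b c d : 'I_n) : bool :=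
  [&& a < b, b < c, c < d, pi c < pi a, pi a < pi d & pi d < pi b].

Lemma quad2413 n (pi : 'S_n) a b c d :
  increasing (quad a b c d) && order_isomorphic perm2413 pi (quad a b c d)
  = is2413 pi a b c d.
Proof.
rewrite /increasing /order_isomorphic /is2413 !forall_ord4 !perm2413E !ffunE /=.
lia.
Qed.

Lemma min_value_quad2413 n (pi : 'S_n) a b c d :
  is2413 pi a b c d -> min_value pi (quad a b c d) = pi c.
Proof.
rewrite /min_value !big_ord_recl big_ord0 !ffunE /is2413 /=.
have := ltn_ord (pi c); lia.
Qed.

Lemma max_value_quad2413 n (pi : 'S_n) a b c d :
  is2413 pi a b c d -> max_value pi (quad a b c d) = pi b.
Proof. by rewrite /max_value !big_ord_recl big_ord0 !ffunE /is2413 /=; lia. Qed.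

Lemma sorted_values_quad2413 n (pi : 'S_n) a b c d :
  is2413 pi a b c d ->
  sorted_values pi (quad a b c d) = [:: val (pi c); val (pi a); val (pi d); val (pi b)].
Proof.
move=> occ; rewrite /sorted_values.
apply: (@sorted_eq _ leq leq_trans anti_leq); first exact: (sort_sorted leq_total).
  by move: occ; rewrite /is2413 /=; lia.
rewrite perm_sort /image_mem !enum_ordSl /= !ffunE /=.
rewrite (size0nil (size_enum_ord 0)) /=.
by apply/seq.permP=> p /=; do 4!case: (p _).
Qed.

(** * Occurrences of the three patterns *)

(** The selected entries themselves can be left out of the emptiness condition:
    the outer two are not strictly inside in position, nor the middle two in
    value. *)
Lemma contains_BoxP n (pi : 'S_n) :
  contains (Box perm2413) pi <->
  exists a b c d, is2413 pi a b c d /\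
    forall j : 'I_n, a < j < d -> ~~ (pi c < pi j < pi b).
Proof.
rewrite /contains exists_quad /Box.
split=> -[a [b [c [d]]]].
  rewrite andbA quad2413 => /andP[occ]; rewrite (min_value_quad2413 occ).
  rewrite (max_value_quad2413 occ) !ffunE /= => /existsPn noj.
  exists a, b, c, d; split=> // j lt_ajd; apply/negP => lt_cjb.
  have := noj j; rewrite lt_ajd lt_cjb !andbT => /negPn/codomP[r def_j].
  move: lt_ajd lt_cjb; rewrite def_j ffunE; case: r {def_j} => [[|[|[|[|//]]]]] /=; lia.
case=> occ noj; exists a, b, c, d.
rewrite andbA quad2413 occ (min_value_quad2413 occ) (max_value_quad2413 occ) !ffunE /=.
apply/existsPn => j; apply/negP => /and3P[_ lt_ajd lt_cjb].
by case/negP: (noj j lt_ajd).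
Qed.

Lemma forall_index2 (P : pred 'I_3) : [forall x in [set index2], P x] = P index2.
Proof.
apply/forall_inP/idP => [PT | Pi x]; first by apply: PT; rewrite inE.
by move/set1P->.
Qed.

Lemma quad_adjacent n (a b c d : 'I_n) :
  [forall x in [set index2],
     quad a b c d (lift ord0 x) == (quad a b c d (widen_ord (leqnSn 3) x)).+1 :> nat]
  = (c == b.+1 :> nat).
Proof. by rewrite forall_index2 !ffunE. Qed.

Lemma contains_vincularP n (pi : 'S_n) :
  contains (vincular perm2413 [set index2]) pi <->
  exists a b c d : 'I_n, is2413 pi a b c d /\ c = b.+1 :> nat.
Proof.
rewrite /contains exists_quad /vincular /bivincular.
split=> -[a [b [c [d]]]].
  by rewrite andbA quad2413 quad_adjacent => /and3P[occ /eqP adj _]; exists a, b, c, d.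
case=> occ adj; exists a, b, c, d; rewrite andbA quad2413 quad_adjacent occ adj eqxx /=.
by apply/forall_inP => y; rewrite inE.
Qed.

Lemma contains_bivincularP n (pi : 'S_n) :
  contains (bivincular perm2413 [set index2] [set index2]) pi <->
  exists a b c d : 'I_n,
    [/\ is2413 pi a b c d, c = b.+1 :> nat & pi d = (pi a).+1 :> nat].
Proof.
rewrite /contains exists_quad /bivincular.
split=> -[a [b [c [d]]]].
  rewrite andbA quad2413 quad_adjacent forall_index2 => /and3P[occ /eqP adj].
  by rewrite (sorted_values_quad2413 occ) => /eqP vadj; exists a, b, c, d.
case=> occ adj vadj; exists a, b, c, d.
rewrite andbA quad2413 quad_adjacent forall_index2 occ (sorted_values_quad2413 occ).
by rewrite adj /= vadj !eqxx.
Qed.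

(** * Comparison of the three patterns *)

(** The largest index up to y satisfying P is not y, and its successor must
    fail P. *)
Lemma ord_crossing n (P : pred 'I_n) (x y : 'I_n) :
  x <= y -> P x -> ~~ P y ->
  exists u v : 'I_n, [/\ x <= u, v = u.+1 :> nat, v <= y, P u & ~~ P v].
Proof.
move=> le_xy Px nPy; pose Q (u : 'I_n) := (u <= y) && P u.
have Qx : Q x by rewrite /Q le_xy.
case: (arg_maxnP val Qx) => u /andP[le_uy Pu] max_u.
have lt_uy : u < y.
  by rewrite ltn_neqAle le_uy andbT; apply: contraNneq nPy => /val_inj <-.
exists u, (Ordinal (leq_ltn_trans lt_uy (ltn_ord y))); split=> //; first exact: max_u.
apply/negP=> Pv; have := max_u _ (introT andP (conj lt_uy Pv)).
by rewrite /= ltnn.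
Qed.

(** Crossing in position: the property of having a value at least pi b holds at
    b and fails at c; the entry right after the crossing is below pi b, hence
    at most pi c because the box is empty. *)
Lemma vincular_of_Box n (pi : 'S_n) :
  contains (Box perm2413) pi -> contains (vincular perm2413 [set index2]) pi.
Proof.
rewrite contains_BoxP contains_vincularP => -[a [b [c [d [occ empty_box]]]]].
have /and5P[lt_ab lt_bc lt_cd lt_pca /andP[lt_pad lt_pdb]] := occ.
have [u [v [le_bu def_v le_vc le_pbu]]] :=
  @ord_crossing _ (fun j => pi b <= pi j) _ _ (ltnW lt_bc) (leqnn _)
    ltac:(rewrite -ltnNge; lia).
rewrite -ltnNge => lt_pvb; exists a, u, v, d; split=> //.
have := empty_box v; rewrite /is2413; lia.
Qed.

(** Crossing in value: the property of sitting at a position at most b holds for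
    the value pi a and fails for pi d. *)
Lemma bivincular_of_vincular n (pi : 'S_n) :
  contains (vincular perm2413 [set index2]) pi ->
  contains (bivincular perm2413 [set index2] [set index2]) pi.
Proof.
rewrite contains_vincularP contains_bivincularP => -[a [b [c [d [occ adj]]]]].
have /and5P[lt_ab lt_bc lt_cd lt_pca /andP[lt_pad lt_pdb]] := occ.
have [||u [v [le_au def_v le_vd le_ub]]] :=
  @ord_crossing _ (fun v => (pi^-1)%g v <= b) _ _ (ltnW lt_pad).
- by rewrite permK ltnW.
- by rewrite permK -ltnNge; lia.
rewrite -ltnNge => lt_bv; exists ((pi^-1)%g u), b, c, ((pi^-1)%g v).
split; rewrite ?permKV //.
(* The values pi b and pi c lie outside the range from pi a to pi d, so neither
   of the two new values sits at b or c. *)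
have neq_u : (pi^-1)%g u != b :> nat.
  by apply/eqP => /val_inj def_b; move: (permKV pi u); rewrite def_b => /(congr1 val) /=; lia.
have neq_v : (pi^-1)%g v != c :> nat.
  by apply/eqP => /val_inj def_c; move: (permKV pi v); rewrite def_c => /(congr1 val) /=; lia.
rewrite /is2413 !permKV; lia.
Qed.

(** The pair b, c may have to be given up: in 2 4 5 1 3 the box of the
    occurrence 2 5 1 3 contains 4.  The outer positions are optimised first,
    and the middle entries are then pushed towards each other in value, no
    longer adjacent in position. *)
Lemma Box_of_vincular n (pi : 'S_n) :
  contains (vincular perm2413 [set index2]) pi -> contains (Box perm2413) pi.
Proof.
rewrite contains_vincularP contains_BoxP => -[a0 [b [c [d0 [occ0 adj]]]]].
pose Q (p : 'I_n * 'I_n) := is2413 pi p.1 b c p.2.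
have Q0 : Q (a0, d0) by [].
have [[a d] occ min_ad] := arg_minnP (fun p : 'I_n * 'I_n => p.2 - p.1) Q0.
have {Q0 occ0 a0 d0} narrower a' d' : is2413 pi a' b c d' -> d - a <= d' - a'.
  by move=> occ'; exact: (min_ad (a', d')).
have {Q min_ad} occ : is2413 pi a b c d by [].
have /and5P[lt_ab lt_bc lt_cd lt_pca /andP[lt_pad lt_pdb]] := occ.
have pi_eq (i j : 'I_n) : (pi i == pi j :> nat) = (i == j :> nat).
  by rewrite !val_eqE (inj_eq perm_inj).
(* An entry violating one of the next two claims could replace a, respectively
   d, and narrow the occurrence. *)
have left_gap (j : 'I_n) : a < j < b -> ~~ (pi c < pi j < pi d).
  by move=> ltj; apply/negP => pj; have := narrower j d; rewrite /is2413; lia.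
have right_gap (j : 'I_n) : c < j < d -> ~~ (pi a < pi j < pi b).
  by move=> ltj; apply/negP => pj; have := narrower a j; rewrite /is2413; lia.
pose high (j : 'I_n) := (a < j < d) && (pi d < pi j).
pose low (j : 'I_n) := (a < j < d) && (pi j < pi a).
have [b' /andP[in_b' high_b'] min_b'] :=
  @arg_minnP _ b high (fun j => pi j) ltac:(rewrite /high; lia).
have [c' /andP[in_c' low_c'] max_c'] :=
  @arg_maxnP _ c low (fun j => pi j) ltac:(rewrite /low; lia).
have le_pb : pi b' <= pi b by apply: min_b'; rewrite /high; lia.
have le_pc : pi c <= pi c' by apply: max_c'; rewrite /low; lia.
(* A position of b' beyond c would violate right_gap, as pi b' lies above pi d
   and is at most pi b; symmetrically for c' and left_gap. *)
have le_b : b' <= b.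
  have := right_gap b'; have := pi_eq b' b; have := pi_eq b' c; lia.
have le_c : c <= c'.
  have := left_gap c'; have := pi_eq c' b; have := pi_eq c' c; lia.
exists a, b', c', d; split=> [|j in_j]; first by rewrite /is2413; lia.
apply/negP=> box_j.
have mid_j : ~~ (pi a < pi j < pi d).
  by apply/negP=> pj; have := narrower a j; have := narrower j d;
     have := pi_eq j b; have := pi_eq j c; rewrite /is2413; lia.
have := pi_eq j a; have := pi_eq j d.
have := min_b' j; have := max_c' j; rewrite /high /low; lia.
Qed.

Theorem corollary5p3 :
  [/\ coincident (Box perm2413) (vincular perm2413 [set index2]),
      coincident (Box perm2413) (bivincular perm2413 [set index2] [set index2])
    & coincident (vincular perm2413 [set index2])
                 (bivincular perm2413 [set index2] [set index2])].
Proof.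
have eqBV n (pi : 'S_n) :
    contains (Box perm2413) pi = contains (vincular perm2413 [set index2]) pi.
  by apply/idP/idP; [exact: vincular_of_Box | exact: Box_of_vincular].
have eqVW n (pi : 'S_n) :
    contains (vincular perm2413 [set index2]) pi
    = contains (bivincular perm2413 [set index2] [set index2]) pi.
  apply/idP/idP; first exact: bivincular_of_vincular.
  rewrite contains_bivincularP contains_vincularP => -[a [b [c [d [occ adj _]]]]].
  by exists a, b, c, d.
by split=> n pi; rewrite /avoids ?eqBV ?eqVW.
Qed.
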